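(* Let $A\geq a\geq 1$ and $r\geq 1$ be integers, and let $Nmes_{r,A,a}$ be the set of overpartitions $\pi$ such that all parts of $\pi$ of size $\equiv a\pmod A$ and less than $mes_{r,A,a}(\pi)$ are non-overlined. Then \[ \sum_{\pi\in Nmes_{r,A,a}}z^{mes_{r,A,a}(\pi)}q^{|\pi|}=\frac{(-q;q)_{\infty}}{(q;q)_{\infty}}\sum_{k=0}^{\infty}z^{kA+a}\bigg[\frac{q^{r[A\binom{k}{2}+ka]}}{(-q^a;q^A)_k}-\frac{2 q^{r[A\binom{k+1}{2}+(k+1)a]}}{(-q^a;q^A)_{k+1}}\bigg]. \]
   Context: An overpartition is a partition (finite non-increasing sequence of positive integers) in which the first occurrence of each part value may be overlined; $|\pi|$ is the sum of parts. A part is of size $t$ if it equals $t$ or $\overline{t}$. $(a;q)_\infty=\prod_{i\geq0}(1-aq^i)$, $(a;q)_n=(a;q)_\infty/(aq^n;q)_\infty$; $|q|<1$, $z$ a formal variable. For $r\geq1$, $mes_{r,A,a}(\pi)$ is the smallest positive integer $\equiv a\pmod A$ such that there are fewer than $r$ parts of size $mes_{r,A,a}(\pi)$ in $\pi$. *)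

(* Defs.v *)
From HB Require Import structures.
From mathcomp Require Import all_boot all_order all_algebra finmap complex.
From mathcomp Require Import boolp classical_sets functions reals.
From mathcomp Require Import topology normedtype sequences.
From mathcomp.analysis.showcase Require Import summability.

Set Implicit Arguments.
Unset Strict Implicit.
Unset Printing Implicit Defensive.

Import Order.TTheory GRing.Theory Num.Theory.
Import numFieldNormedType.Exports.

Local Open Scope classical_set_scope.
Local Open Scope ring_scope.

(* A part is a pair (t, b) of its size t and a flag b, set when the part is
   overlined. *)
Definition part_sizes (s : seq (nat * bool)) : seq nat := map fst s.

Definition overlines_first (s : seq (nat * bool)) : bool :=
  all (fun i => let p := nth (0%N, false) s i in
         p.2 ==> (p.1 \notin take i (part_sizes s)))
      (iota 0 (size s)).

Definition is_overpartition (s : seq (nat * bool)) : bool :=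
  [&& sorted geq (part_sizes s), all (ltn 0) (part_sizes s)
    & overlines_first s].

Record overpartition : Type := Overpartition {
  parts :> seq (nat * bool);
  partsP : is_overpartition parts
}.

HB.instance Definition _ := [isSub for parts].
HB.instance Definition _ := [Countable of overpartition by <:].

Definition weight (p : overpartition) : nat := sumn (part_sizes p).

Definition nparts (p : overpartition) (t : nat) : nat :=
  count_mem t (part_sizes p).

Definition mes_cond (r A a : nat) (p : overpartition) (m : nat) : bool :=
  [&& 0 < m, m == a %[mod A] & nparts p m < r]%N.

(* The junk value 0 is never taken when A and r are positive, see mesP. *)
Definition mes (r A a : nat) (p : overpartition) : nat :=
  if pselect (exists m, mes_cond r A a p m) is left h then ex_minn h else 0%N.

Lemma mesP (r A a : nat) (p : overpartition) : (0 < A)%N -> (0 < r)%N ->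
  mes_cond r A a p (mes r A a p) /\
  (forall m, mes_cond r A a p m -> mes r A a p <= m)%N.
Proof.
move=> A0 r0; rewrite /mes; case: pselect => [h|[]].
  by case: ex_minnP => m Pm minm; split.
pose N := (sumn (part_sizes p)).+1.
exists (N * A + a)%N; rewrite /mes_cond addn_gt0 muln_gt0 A0 /= modnMDl eqxx /=.
rewrite /nparts; suff /count_memPn -> : (N * A + a)%N \notin part_sizes p by [].
apply/negP => inp.
have le_sumn (s : seq nat) x : x \in s -> (x <= sumn s)%N.
  elim: s => //= y s IH; rewrite inE => /orP[/eqP->|/IH xs].
    exact: leq_addr.
  exact: leq_trans xs (leq_addl _ _).
have := le_sumn _ _ inp; apply/negP; rewrite -ltnNge.
by apply: leq_trans (leq_addr _ _); rewrite leq_pmulr.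
Qed.

Definition Nmes (r A a : nat) : pred overpartition := fun p =>
  all (fun x : nat * bool =>
         (x.1 == a %[mod A]) && (x.1 < mes r A a p)%N ==> ~~ x.2) p.

Definition qpoch_inf (K : numFieldType) (x q : K) : K :=
  lim ((\prod_(i < n) (1 - x * q ^+ i)) @[n --> \oo]).

Definition qpoch (K : numFieldType) (x q : K) (n : nat) : K :=
  qpoch_inf x q / qpoch_inf (x * q ^+ n) q.

(* Formal power series in z, given by their coefficients.  An infinite sum of
   such series is taken coefficientwise, each coefficient being an unordered
   sum in K, i.e. a limit over the directed set of finite sets of indices. *)
Definition zseries (K : numFieldType) : Type := nat -> K.

Definition zmonomial (K : numFieldType) (c : K) (n : nat) : zseries K :=
  fun m => if m == n then c else 0.

Definition zscale (K : numFieldType) (c : K) (f : zseries K) : zseries K :=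
  fun m => c * f m.

Definition zsummable (K : numFieldType) (I : choiceType)
    (f : I -> zseries K) : Prop :=
  forall m, cvg (partial_sum (fun i => f i m) @ totally).

Definition zsum (K : numFieldType) (I : choiceType)
    (f : I -> zseries K) : zseries K :=
  fun m => lim (partial_sum (fun i => f i m) @ totally).

(* Main.v *)
(* Write y = q ^ t.  An overpartition is an independent choice, for every size
   t, of a multiplicity and of a flag telling whether the first part of size t
   is overlined.  Membership in Nmes together with mes = k A + a only
   constrains the sizes t = j A + a with j <= k: the local generating function
   (1 + y) / (1 - y) is replaced by y ^ r / (1 - y) when j < k (at least r
   parts, none overlined) and by (1 + y - 2 y ^ r) / (1 - y) when j = k (fewer
   than r parts).  Dividing by the unconstrained factors leaves
   y ^ r / (1 + y) and 1 - 2 y ^ r / (1 + y), whose product is the bracket of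
   the formula.

   Analytically, the overpartitions with sizes at most N and multiplicities at
   most M have as generating polynomial a product of truncated local sums,
   which tends to the right-hand side as M and then N go to infinity, both at q
   and at |q|; this yields unordered convergence. *)
Require Import Defs.
From mathcomp Require Import all_boot all_order all_algebra finmap complex.
From mathcomp Require Import boolp classical_sets functions reals.
From mathcomp Require Import topology normedtype sequences exp.
From mathcomp Require Import ring lra zify.
From mathcomp.analysis.showcase Require Import summability.

Set Implicit Arguments.
Unset Strict Implicit.
Unset Printing Implicit Defensive.

Import Order.TTheory GRing.Theory Num.Theory.
Import numFieldNormedType.Exports.

Local Open Scope classical_set_scope.
Local Open Scope ring_scope.

#[local] Existing Instance totally_filter.

(** * Convergence in the complex numbers *)

(* [R[i]] packed as a [numFieldType], which gives it the norm topology. *)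
Definition cplx (R : realType) : numFieldType := R[i].

Local Open Scope complex_scope.
Local Notation normc := ComplexField.Normc.normc.

Lemma normrE_normc (R : realType) (z : cplx R) : `|z| = (normc z)%:C.
Proof. by []. Qed.

Lemma ger_Re_normc (R : realType) (z : R[i]) : `|complex.Re z| <= normc z.
Proof.
by case: z => a b /=; rewrite -sqrtr_sqr ler_wsqrtr // lerDl sqr_ge0.
Qed.

Lemma ger_Im_normc (R : realType) (z : R[i]) : `|complex.Im z| <= normc z.
Proof.
by case: z => a b /=; rewrite -sqrtr_sqr ler_wsqrtr // lerDr sqr_ge0.
Qed.

Lemma normc_ge0 (R : realType) (z : R[i]) : 0 <= normc z.
Proof. exact: le_trans (ger_Re_normc z). Qed.

Lemma gt0_real_complex (R : realType) (e : cplx R) : 0 < e ->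
  exists2 d : R, 0 < d & e = d%:C.
Proof. by case: e => a b; rewrite ltcE /= => /andP[/eqP-> a0]; exists a. Qed.

Lemma cvgn_dist (K : numFieldType) (u : nat -> K) (l : K) :
  (forall e, 0 < e -> \forall n \near \oo, `|l - u n| < e) ->
  u n @[n --> \oo] --> l.
Proof. by move=> h; apply/cvgrPdist_lt. Qed.

Lemma cvg_expr_lt1 (R : realType) (y : cplx R) : `|y| < 1 ->
  y ^+ n @[n --> \oo] --> (0 : cplx R).
Proof.
move=> y1; apply/cvgrPdist_lt => e /gt0_real_complex[d d0 ->].
have t1 : `|normc y| < 1.
  by rewrite ger0_norm ?normc_ge0 // -ltcR.
have /cvgrPdist_lt/(_ _ d0) := cvg_expr t1.
apply: filterS => n; rewrite !sub0r !normrN normrX ger0_norm ?normc_ge0 // => h.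
by rewrite normrX normrE_normc -rmorphXn ltcR.
Qed.

(* Both v and Re u + v (likewise Im u + v) are nondecreasing and bounded, so
   u converges without an appeal to completeness of the complex numbers. *)
Lemma cvg_dominated_increments (R : realType) (u : nat -> cplx R)
    (v : nat -> R) (B : R) :
  (forall n, `|u n.+1 - u n| <= (v n.+1 - v n)%:C) -> (forall n, v n <= B) ->
  exists l : cplx R, u n @[n --> \oo] --> l.
Proof.
move=> duv vB.
have key (p : R[i] -> R) : {morph p : x y / x - y} ->
    (forall z, `|p z| <= normc z) -> cvgn (fun n => p (u n)).
  move=> pB pn.
  have d n : `|p (u n.+1) - p (u n)| <= v n.+1 - v n.
    by rewrite -pB; apply: le_trans (pn _) _; rewrite -lecR; exact: duv.
  have bd n : p (u n) <= p (u 0%N) + v n - v 0%N.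
    elim: n => [|n IH]; first by lra.
    by have := d n; rewrite ler_norml => /andP[_]; lra.
  have cv : cvgn v.
    apply: nondecreasing_is_cvgn; last by exists B => _ [n _ <-].
    apply/nondecreasing_seqP => n.
    by rewrite -subr_ge0; exact: le_trans (d n).
  have cpv : cvgn (fun n => p (u n) + v n).
    apply: nondecreasing_is_cvgn.
      apply/nondecreasing_seqP => n.
      by have := d n; rewrite ler_norml => /andP[]; lra.
    exists (p (u 0%N) + B - v 0%N + B) => _ [n _ <-].
    by have := bd n; have := vB n; lra.
  have -> : (fun n => p (u n)) = (fun n => p (u n) + v n) - v.
    by apply/funext => n; rewrite !fctE addrK.
  exact: is_cvgB.
have /cvg_ex[/= x cx] :=
  key (@complex.Re R) (fun x y => raddfB _ x y) (@ger_Re_normc R).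
have /cvg_ex[/= y cy] :=
  key (@complex.Im R) (fun x y => raddfB _ x y) (@ger_Im_normc R).
pose l : cplx R := x +i* y; exists l.
apply: (@cvgn_dist (cplx R)) => e /gt0_real_complex[d d0 ->].
have d2 : 0 < d / 2 by lra.
have /cvgrPdist_lt/(_ _ d2) {}cx := cx; have /cvgrPdist_lt/(_ _ d2) {}cy := cy.
near=> n.
have h1 : `|x - complex.Re (u n)| < d / 2 by near: n.
have h2 : `|y - complex.Im (u n)| < d / 2 by near: n.
rewrite normrE_normc ltcR /l; case: (u n) h1 h2 => a b /= h1 h2.
rewrite -(ger0_norm (ltW d0)) -(sqrtr_sqr d) ltr_sqrt; last nra.
rewrite -(real_normK (num_real (x - a))) -(real_normK (num_real (y - b))).
have := normr_ge0 (x - a); have := normr_ge0 (y - b); nra.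
Unshelve. all: by end_near. Qed.

(** * Convergence of infinite products and nonvanishing of their limits *)

Lemma sum_expr_le (R : realType) (t : R) n : 0 <= t < 1 ->
  \sum_(i < n) t ^+ i <= (1 - t)^-1.
Proof.
move=> /andP[t0 t1]; rewrite -[leRHS]mul1r ler_pdivlMr ?subr_gt0 //.
by rewrite mulrC -opprB mulNr -subrX1 opprB gerBl exprn_ge0.
Qed.

(** The increments of the product are dominated by those of the real product of the
    [1 + y * t ^+ i], which stays below [expR (y / (1 - t))] because [1 + u <= expR u]. *)
Lemma cvg_prodr (R : realType) (c : nat -> cplx R) (y t : R) :
  0 <= t < 1 -> (forall i, `|c i| <= (y * t ^+ i)%:C) ->
  exists l : cplx R, \prod_(i < n) (1 + c i) @[n --> \oo] --> l.
Proof.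
move=> t01 cy.
have y0 i : 0 <= y * t ^+ i by rewrite -ler0c; exact: le_trans (cy i).
have y00 : 0 <= y by have := y0 0%N; rewrite mulr1.
pose v n : R := \prod_(i < n) (1 + y * t ^+ i).
have vB n : v n <= expR (y / (1 - t)).
  apply: (@le_trans _ _ (\prod_(i < n) expR (y * t ^+ i))).
    apply: ler_prod => i _; rewrite expR_ge1Dx andbT.
    by have := y0 i; lra.
  rewrite -expR_sum ler_expR -mulr_sumr ler_wpM2l //.
  exact: sum_expr_le.
apply: cvg_dominated_increments vB => n.
rewrite /v !big_ord_recr /= !mulrDr !mulr1 ![_ + _ * _]addrC !addrK.
rewrite normrM normr_prod rmorphM rmorph_prod /=.
apply: ler_pM => //; [exact: prodr_ge0|].
apply: ler_prod => i _; rewrite normr_ge0 /=.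
rewrite rmorphD /=; apply: le_trans (ler_normD _ _) _.
by rewrite normr1 lerD2l cy.
Qed.

Lemma cvgn_unit (K : numFieldType) (u w : nat -> K) (l m : K) :
  (forall n, u n * w n = 1) -> u n @[n --> \oo] --> l ->
  w n @[n --> \oo] --> m -> l != 0.
Proof.
move=> uw cu cw; have : u n * w n @[n --> \oo] --> l * m by exact: cvgM.
under eq_fun do rewrite uw.
move=> /(cvg_unique _ (cvg_cst _)) => /(_ (@norm_hausdorff _ _)) lm.
by apply/eqP => l0; move/eqP: lm; rewrite l0 mul0r oner_eq0.
Qed.

(* The limit is nonzero because the inverse products converge as well. *)
Lemma cvg_qpoch_inf (R : realType) (x q : cplx R) : `|x| < 1 -> `|q| < 1 ->
  exists2 l : cplx R, l != 0 &
    \prod_(i < n) (1 - x * q ^+ i) @[n --> \oo] --> l.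
Proof.
move=> x1 q1.
have t01 : 0 <= normc q < 1 by rewrite normc_ge0 -ltcR; exact: q1.
have nx1 : 0 <= normc x < 1 by rewrite normc_ge0 -ltcR; exact: x1.
have le1 i : `|x * q ^+ i| <= `|x|.
  by rewrite normrM normrX ler_piMr // exprn_ile1 // ltW.
have nz i : 1 - x * q ^+ i != 0.
  rewrite subr_eq0; apply: contraTneq x1 => e.
  by apply/negP => /(le_lt_trans (le1 i)); rewrite -e normr1 ltxx.
have [|l cl] := @cvg_prodr R (fun i => - (x * q ^+ i)) (normc x) _ t01.
  by move=> i; rewrite normrN normrM normrX rmorphM rmorphXn.
(* With [w = x * q ^+ i], the inverse of [1 - w] is [1 + w / (1 - w)], so the inverse product has
   the same shape; the constant comes from [|1 - w| >= 1 - |x|]. *)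
have [|m cm] := @cvg_prodr R (fun i => x * q ^+ i / (1 - x * q ^+ i))
    (normc x / (1 - normc x)) _ t01.
  move=> i; rewrite normrM normfV normrM normrX mulrAC.
  rewrite rmorphM rmorphXn fmorph_div rmorphB rmorph1 /=.
  apply: ler_wpM2r; first by rewrite exprn_ge0.
  apply: ler_wpM2l => //; rewrite lef_pV2 ?posrE ?normr_gt0 ?nz //; last first.
    by rewrite subr_gt0.
  have := lerB_normD 1 (- (x * q ^+ i)); rewrite normr1 normrN.
  by apply: le_trans; rewrite lerD2l lerN2; exact: le1.
exists l; last exact: cl.
apply: (@cvgn_unit (cplx R) _ _ l m _ cl cm) => n.
rewrite -big_split /= big1 // => i _.
have := nz i; set w := x * _ => w1.
by rewrite -{2}(mulfV w1) -mulrDl subrK mul1r mulfV.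
Qed.

Local Close Scope complex_scope.

(** * Unordered sums *)

Lemma ler_sum_subseq (K : numDomainType) (I : eqType) (s s' : seq I)
    (P : pred I) (F : I -> K) :
  uniq s -> uniq s' -> (forall i, 0 <= F i) ->
  (forall i, i \in s -> P i -> i \in s') ->
  \sum_(i <- s | P i) F i <= \sum_(i <- s') F i.
Proof.
move=> us us' F0 ss'.
have -> : \sum_(i <- s | P i) F i = \sum_(i <- s' | (i \in s) && P i) F i.
  rewrite -[LHS]big_filter -[RHS]big_filter; apply: perm_big.
  apply: uniq_perm; rewrite ?filter_uniq // => i; rewrite !mem_filter.
  by case Pi: (P i); case si: (i \in s); rewrite //= ss'.
by rewrite big_mkcond /=; apply: ler_sum => i _; case: ifP.
Qed.

Lemma partial_sum_seq (K : zmodType) (I : choiceType) (f : I -> K)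
    (J : {fset I}) : partial_sum f J = \sum_(i <- J) f i.
Proof. by rewrite big_seq_fsetE. Qed.

(* Finite sets s almost attaining both the sum L of f and the sum L' of |f|
   exist beyond any J; comparing two of them bounds the sum of |f| over J
   minus s, so neither completeness nor an order limit is needed. *)
Lemma cvg_partial_sum (K : numFieldType) (I : choiceType) (f : I -> K)
    (L L' : K) :
  (forall (J : {fset I}) e, 0 < e -> exists s : seq I,
     [/\ uniq s, (forall i, i \in J -> f i != 0 -> i \in s),
         `|L - \sum_(i <- s) f i| < e & `|L' - \sum_(i <- s) `|f i| | < e]) ->
  partial_sum f J @[J --> totally] --> L.
Proof.
move=> H; apply/cvgrPdist_lt => e e0.
have e3 : 0 < e / 3%:R by rewrite divr_gt0.
have [s0 [us0 _ fs0 ns0]] := H fset0 _ e3.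
exists [fset x in s0]%fset => // J /= sJ; rewrite partial_sum_seq.
have [s1 [us1 sub1 _ ns1]] := H J _ e3.
have split (g : I -> K) : \sum_(i <- J) g i =
    \sum_(i <- s0) g i + \sum_(i <- J | i \notin s0) g i.
  rewrite (bigID (mem s0)) /=; congr (_ + _).
  rewrite -big_filter; apply: perm_big; apply: uniq_perm => //.
    exact/filter_uniq/fset_uniq.
  move=> i; rewrite mem_filter andb_idr // => si.
  by apply: (fsubsetP sJ); rewrite inE.
have tail : \sum_(i <- J | i \notin s0) `|f i| <=
    \sum_(i <- s1) `|f i| - \sum_(i <- s0) `|f i|.
  rewrite lerBrDl -split.
  (* Indices of [J] where [f] vanishes may lie outside [s1]; they are discarded before comparing. *)
  rewrite (bigID (fun i => f i == 0)) /= big1 ?add0r; last first.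
    by move=> i /eqP->; rewrite normr0.
  by apply: ler_sum_subseq => //; exact: fset_uniq.
rewrite split opprD addrA.
have -> : e = e / 3%:R + (e / 3%:R + e / 3%:R).
  by field.
apply: le_lt_trans (ler_normB _ _) _; rewrite ltrD //.
apply: le_lt_trans (ler_norm_sum _ _ _) _; apply: le_lt_trans tail _.
(* The order of [K] is only partial: a difference is bounded by its norm because both sums are real.
   Passing through [L'] then costs two thirds of [e]. *)
apply: le_lt_trans (real_ler_norm _) _.
  by rewrite realB // ger0_real // sumr_ge0.
rewrite -(subrK L' (\sum_(i <- s1) _)) -addrA.
apply: le_lt_trans (ler_normD _ _) _.
by rewrite distrC ltrD.
Qed.

Lemma cvg_partial_sum1 (K : numFieldType) (I : choiceType) (f : I -> K) i0 :
  (forall i, i != i0 -> f i = 0) ->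
  partial_sum f J @[J --> totally] --> f i0.
Proof.
move=> f0; apply: (@cvg_partial_sum _ _ _ _ `|f i0|) => J e e0.
exists [:: i0]; rewrite !big_seq1 !subrr normr0; split=> // i _.
by rewrite inE; apply: contraR => /f0 ->.
Qed.

Lemma cvg_partial_sum0 (K : numFieldType) (I : choiceType) (f : I -> K) :
  (forall i, f i = 0) -> partial_sum f J @[J --> totally] --> (0 : K).
Proof.
move=> f0; apply: (@cvg_partial_sum _ _ _ _ 0) => J e e0.
by exists [::]; rewrite !big_nil subrr normr0; split=> // i _; rewrite f0 eqxx.
Qed.

(** * Enumeration of truncated overpartitions *)

(** Serves to lift a list of raw sequences to a list of overpartitions in [Nmes]. *)
Lemma exists_map (I : Type) (U : eqType) (g : I -> U) (u : seq U) :
  (forall x, x \in u -> exists i, g i = x) -> exists s, map g s = u.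
Proof.
elim: u => [|x u IH] h; first by exists [::].
have [i gi] := h x (mem_head _ _).
have [y yu|s gs] := IH; first by apply: h; rewrite inE yu orbT.
by exists (i :: s); rewrite /= gi gs.
Qed.

Lemma leq_sumn (s : seq nat) x : x \in s -> (x <= sumn s)%N.
Proof. by elim: s => //= y s IH; rewrite inE => /orP[/eqP->|/IH]; lia. Qed.

Lemma count_mem_leq_sumn (s : seq nat) x : (0 < x)%N ->
  (count_mem x s <= sumn s)%N.
Proof. by move=> x0; elim: s => //= y s IH; case: eqP => [->|_] /=; lia. Qed.

(** Relates an earlier entry [x] to a later entry [y]. Being pairwise, the condition behaves well
    under concatenation and filtering, unlike the positional one. *)
Definition overpart_rel : rel (nat * bool) :=
  fun x y => (y.1 <= x.1)%N && (y.2 ==> (y.1 != x.1)).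

(** Induction from the right: appending an entry leaves the earlier prefixes unchanged and adds a
    single test, of the new entry against all the others. *)
Lemma overlines_first_pairwise (s : seq (nat * bool)) :
  overlines_first s = pairwise (fun x y => y.2 ==> (y.1 != x.1)) s.
Proof.
elim/last_ind: s => // s x IH.
rewrite pairwise_rcons -IH /overlines_first size_rcons -addn1 iotaD cats1.
rewrite all_rcons add0n nth_rcons ltnn eqxx /part_sizes map_rcons -cats1.
rewrite take_size_cat ?size_map //.
congr (_ && _).
  case: x => t [] /=; last by rewrite all_predT.
  by elim: s {IH} => //= y s <-; rewrite inE negb_or.
apply: eq_in_all => i; rewrite mem_iota add0n => /andP[_ lt_is].
by rewrite nth_rcons lt_is takel_cat // size_map ltnW.
Qed.

Lemma is_overpartitionE (s : seq (nat * bool)) :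
  is_overpartition s = all (fun x => 0 < x.1)%N s && pairwise overpart_rel s.
Proof.
rewrite /is_overpartition overlines_first_pairwise /part_sizes all_map.
rewrite sorted_pairwise; last by move=> ? ? ? /[swap]; exact: leq_trans.
by rewrite pairwise_map andbCA -pairwise_relI.
Qed.

(** * Building overpartitions from independent local choices *)

Definition profile (s : seq (nat * bool)) (t : nat) : nat * bool :=
  (count_mem t (part_sizes s), (t, true) \in s).

(** The only admissible arrangement of the parts of size [t]: an overlined one must come first. At
    multiplicity 0 the flag is lost, so [local_choices] excludes [(0, true)], which would count the
    empty block twice. *)
Definition block (t : nat) (c : nat * bool) : seq (nat * bool) :=
  if c.1 is m.+1 then (t, c.2) :: nseq m (t, false) else [::].

Definition local_choices (ok : pred (nat * bool)) (M : nat) :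
    seq (nat * bool) :=
  [seq c <- [seq (m, b) | m <- iota 0 M.+1, b <- [:: false; true]]
     | (c.2 ==> (0 < c.1)%N) && ok c].

(* The overpartitions with parts of size at most N, each size occurring at
   most M times, whose profile at every size t satisfies ok t. *)
Fixpoint truncations (ok : nat -> pred (nat * bool)) (M N : nat) :
    seq (seq (nat * bool)) :=
  if N is n.+1 then
    [seq block N c ++ s | c <- local_choices (ok N) M, s <- truncations ok M n]
  else [:: [::]].

Lemma mem_local_choices ok M c :
  (c \in local_choices ok M) = [&& c.2 ==> (0 < c.1)%N, ok c & (c.1 <= M)%N].
Proof.
rewrite mem_filter -andbA; congr (_ && (_ && _)); case: c => m b.
apply/allpairsP/idP => [[[m' b'] [+ _ [-> _]]]|mM].
  by rewrite mem_iota ltnS.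
exists (m, b); rewrite [X in X \in _]/= mem_iota ltnS !inE.
by split=> //; case: (b).
Qed.

Lemma uniq_local_choices ok M : uniq (local_choices ok M).
Proof.
apply: filter_uniq; apply: allpairs_uniq => //; first exact: iota_uniq.
by move=> [? ?] [? ?] _ _ [-> ->].
Qed.

Lemma all_block (P : pred (nat * bool)) t c :
  (forall b, P (t, b)) -> all P (block t c).
Proof.
move=> Pt; rewrite /block; case: c.1 => //= m.
by rewrite Pt all_nseq Pt orbT.
Qed.

Lemma pairwise_block t c : pairwise overpart_rel (block t c).
Proof.
rewrite /block; case: c.1 => //= m.
rewrite all_nseq /overpart_rel /= leqnn orbT /=.
by elim: m => //= m ->; rewrite all_nseq /= leqnn orbT.
Qed.

Lemma profile_cat s1 s2 t :
  profile (s1 ++ s2) t =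
  ((profile s1 t).1 + (profile s2 t).1, (profile s1 t).2 || (profile s2 t).2)%N.
Proof. by rewrite /profile /part_sizes map_cat count_cat mem_cat. Qed.

Lemma profile_notin s t : all (fun x => x.1 != t) s ->
  profile s t = (0%N, false).
Proof.
move=> /allP h; rewrite /profile; congr pair.
  by apply/count_memPn/negP => /mapP[x /h /eqP nx] tx; case: nx.
by apply/negP => /h /=; rewrite eqxx.
Qed.

Lemma profile_block t c : c.2 ==> (0 < c.1)%N -> profile (block t c) t = c.
Proof.
case: c => [[|m]] [] //= _; rewrite /profile /part_sizes /= map_nseq eqxx.
  by rewrite count_nseq /= eqxx mul1n add1n inE eqxx.
by rewrite count_nseq /= eqxx mul1n add1n inE mem_nseq !xpair_eqE !andbF.
Qed.

(** Sizes do not increase, so all parts of the largest size [N.+1] stand in front, and only the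
    first of them can be overlined. *)
Lemma block_profile N s : all (fun x => x.1 <= N.+1)%N s ->
  pairwise overpart_rel s ->
  s = block N.+1 (profile s N.+1) ++ [seq x <- s | (x.1 <= N)%N].
Proof.
elim: s => //= x s IH /andP[xN sN] /andP[xs ps].
have [lt_xN|] := leqP x.1 N.
  have sN' : all (fun y => y.1 <= N)%N s.
    by apply: sub_all xs => y /andP[yx _]; exact: leq_trans lt_xN.
  rewrite profile_notin /=; first by move/all_filterP: sN' => ->.
  rewrite neq_ltn ltnS lt_xN; apply: sub_all sN' => y yN.
  by rewrite neq_ltn ltnS yN.
move=> Nx; move: xN xs Nx; case: x => t b /= xN xs Nt.
have {xN Nt} et : t = N.+1 by apply/eqP; rewrite eqn_leq xN.
rewrite {}et in xs *.
have nb : (N.+1, true) \in s = false.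
  by apply/negP => /(allP xs); rewrite /overpart_rel /= eqxx andbF.
have {}IH := IH sN ps; rewrite /profile /block /= in IH *.
rewrite eqxx /= add0n inE nb orbF xpair_eqE eqxx /=.
by rewrite {1}IH nb; case: (b); case: count.
Qed.

Lemma truncations_le ok M N s : s \in truncations ok M N ->
  all (fun x => x.1 <= N)%N s.
Proof.
elim: N s => [|N IH] s /=; first by rewrite inE => /eqP->.
case/allpairsP => [[c s'] /= [_ /IH s'N ->]].
rewrite all_cat all_block //=; apply: sub_all s'N => y; exact: leqW.
Qed.

(** Induction on [N], detaching the block of the largest size; the profiles at smaller sizes do not
    see that block. *)
Lemma truncationsP ok M N (s : seq (nat * bool)) :
  reflect [/\ is_overpartition s, all (fun x => x.1 <= N)%N s &
           forall t, (0 < t <= N)%N ->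
             ((profile s t).1 <= M)%N && ok t (profile s t)]
          (s \in truncations ok M N).
Proof.
apply: (iffP idP) => [sT|].
  split; [|exact: truncations_le sT|].
  - elim: N s sT => [|N IH] s /=; first by rewrite inE => /eqP->.
    case/allpairsP => [[c s'] /= [_ sT ->]].
    have := IH _ sT; rewrite !is_overpartitionE => /andP[s'0 s'p].
    rewrite all_cat all_block //= s'0 pairwise_cat pairwise_block s'p !andbT.
    apply/allrelP => x y xb /(allP (truncations_le sT)) yN.
    have /eqP ex : x.1 == N.+1.
      by move: x xb; apply/allP; exact: all_block.
    rewrite /overpart_rel ex leqW //= neq_ltn ltnS yN; exact: implybT.
  - elim: N s sT => [|N IH] s; first by move=> _ t; lia.
    case/allpairsP => [[c s'] [+ sT ->]] t /andP[t0].
    rewrite [(c, s').1]/= [(c, s').2]/= in sT *.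
    rewrite mem_local_choices profile_cat => /and3P[vc okc cM].
    rewrite leq_eqVlt => /orP[/eqP->|tN].
      rewrite profile_block // (@profile_notin s').
        by case: c okc cM {vc} => m b /=; rewrite addn0 orbF => -> ->.
      apply: sub_all (truncations_le sT) => y yN; by rewrite neq_ltn ltnS yN.
    rewrite (@profile_notin (block _ _)); first by apply: IH => //; rewrite t0.
    by apply: all_block => b /=; rewrite neq_ltn tN orbT.
elim: N s => [|N IH] s [os sN oks] /=.
  suff -> : s = [::] by rewrite inE.
  move: os sN; rewrite is_overpartitionE => /andP[+ _].
  by case: s {oks} => //= x s /andP[x0 _] /andP[]; lia.
have := os; rewrite is_overpartitionE => /andP[s0 sp].
rewrite (block_profile sN sp); apply: allpairs_f.
  rewrite mem_local_choices; have /andP[-> ->] := oks N.+1 (ltnSn _).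
  rewrite !andbT; apply/implyP => /= ins; rewrite -has_count has_pred1.
  by apply/mapP; exists (N.+1, true).
apply: IH; split.
- rewrite is_overpartitionE pairwise_filter // andbT.
  by rewrite all_filter; apply: sub_all s0 => x /= ->; exact: implybT.
- exact: filter_all.
move=> t /andP[t0 tN]; have := oks t; rewrite t0 leqW // => /(_ isT).
suff -> : profile [seq x <- s | (x.1 <= N)%N] t = profile s t by [].
rewrite /profile mem_filter /= tN; congr pair.
rewrite /part_sizes !count_map count_filter; apply: eq_count => x /=.
by case: eqP => //= ->.
Qed.

(** Both components of a concatenation can be read back: the choice as the profile at [N.+1], the
    remainder by filtering on size. *)
Lemma uniq_truncations ok M N : uniq (truncations ok M N).
Proof.
elim: N => [|N IH] //=; apply: allpairs_uniq => //.
  exact: uniq_local_choices.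
have inv c s : c \in local_choices (ok N.+1) M -> s \in truncations ok M N ->
    profile (block N.+1 c ++ s) N.+1 = c /\
    [seq x <- block N.+1 c ++ s | (x.1 <= N)%N] = s.
  rewrite mem_local_choices => /and3P[vc _ _] /truncations_le sN; split.
    rewrite profile_cat profile_block // (@profile_notin s).
      by case: c {vc} => m b /=; rewrite addn0 orbF.
    by apply: sub_all sN => y yN; rewrite neq_ltn ltnS yN.
  rewrite filter_cat (all_filterP sN) -[RHS]cat0s; congr (_ ++ _).
  apply/eqP; rewrite -[_ == _]negbK -has_filter -all_predC.
  by apply: all_block => b /=; rewrite ltnn.
move=> _ _ /allpairsP[[c s] [/= cC sT ->]]
  /allpairsP[[c' s'] [/= cC' sT' ->]] /= e.
have [pc fs] := inv _ _ cC sT; have [pc' fs'] := inv _ _ cC' sT'.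
by congr pair; [rewrite -[LHS]pc e | rewrite -[LHS]fs e].
Qed.

(** The weight is additive over blocks, so the sum over independent choices factors as an Euler-type
    product. *)
Lemma sum_truncations (K : comNzRingType) (x : K) ok M N :
  \sum_(s <- truncations ok M N) x ^+ sumn (part_sizes s) =
  \prod_(1 <= t < N.+1) \sum_(c <- local_choices (ok t) M) x ^+ (t * c.1).
Proof.
elim: N => [|N IH]; first by rewrite big_seq1 big_geq.
rewrite big_nat_recr //= -IH big_allpairs_dep /= mulrC mulr_suml.
apply: eq_bigr => c _; rewrite mulr_sumr; apply: eq_bigr => s _.
rewrite /part_sizes map_cat sumn_cat exprD; congr (_ ^+ _ * _).
rewrite /block; case: c.1 => [|m] /=; first by rewrite muln0.
by rewrite map_nseq sumn_nseq mulnS.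
Qed.

(** * Local factors *)

(** The constraint put at size [t] by membership in [Nmes] together with [mes = m]; sizes above [m]
    or outside the residue class are free. *)
Definition mes_profile (r A a m t : nat) (c : nat * bool) : bool :=
  (t == a %[mod A]) ==>
  if (t < m)%N then (r <= c.1)%N && ~~ c.2 else (t == m) ==> (c.1 < r)%N.

Lemma eqmod_arith A a t : (0 < a)%N -> (a <= A)%N -> (0 < t)%N ->
  t == a %[mod A] -> exists k, t = (k * A + a)%N.
Proof.
move=> a0 aA t0 ta.
have le_at : (a <= t)%N.
  rewrite leqNgt; apply/negP => lt_ta; move: ta.
  (* The case [a = A] is separate: [a] then has remainder 0, while [t] is its own nonzero
     remainder. *)
  rewrite (modn_small (leq_trans lt_ta aA)); move: aA; rewrite leq_eqVlt.
  by case/orP => [/eqP->|aA]; rewrite ?modnn ?modn_small //; lia.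
exists ((t - a) %/ A)%N; rewrite divnK ?subnK //.
by rewrite -eqn_mod_dvd.
Qed.

Lemma mes_arith r A a p : (0 < a)%N -> (a <= A)%N -> (0 < r)%N ->
  exists k, mes r A a p = (k * A + a)%N.
Proof.
move=> a0 aA r0.
have [/and3P[m0 ma _] _] := mesP a p (leq_trans a0 aA) r0.
exact: eqmod_arith.
Qed.

(** Minimality of [mes] forces at least [r] parts at each smaller size of the progression.
    Conversely, the condition at [m] gives [mes <= m], and a smaller value would have too many
    parts. *)
Lemma mes_NmesP r A a k (p : overpartition) (m := (k * A + a)%N) :
  (0 < a)%N -> (a <= A)%N -> (0 < r)%N ->
  reflect (forall t, (0 < t)%N -> mes_profile r A a m t (profile p t))
          ((mes r A a p == m) && Nmes r A a p).
Proof.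
move=> a0 aA r0; have A0 := leq_trans a0 aA.
have [mc mmin] := mesP a p A0 r0.
apply: (iffP andP) => [[/eqP em /allP Nm] t t0|ok].
  rewrite em in mc mmin Nm; apply/implyP => ta; have [ltm|lem] := ltnP t m.
    apply/andP; split.
      rewrite leqNgt; apply/negP => lt_r; have := mmin t.
      by rewrite /mes_cond t0 ta => /(_ lt_r); rewrite leqNgt ltm.
    by apply/negP => /Nm /=; rewrite ta ltm.
  by apply/implyP => /eqP->; case/and3P: mc.
have m0 : (0 < m)%N by rewrite addn_gt0 a0 orbT.
have em : mes r A a p = m.
  apply/eqP; rewrite eqn_leq; apply/andP; split.
    apply: mmin; rewrite /mes_cond m0 modnMDl eqxx /=.
    by have := ok m m0; rewrite /mes_profile modnMDl eqxx ltnn eqxx.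
  rewrite leqNgt; apply/negP => ltm; case/and3P: mc => t0 ta.
  have := ok _ t0; rewrite /mes_profile ta ltm /= => /andP[+ _].
  by rewrite leqNgt => /negP.
split; first exact/eqP.
apply/allP => -[t b] tp; rewrite em /=; apply/implyP => /andP[ta ltm].
have t0 : (0 < t)%N.
  have := partsP p; rewrite is_overpartitionE => /andP[/allP/(_ _ tp)]; exact.
have := ok t t0; rewrite /mes_profile ta ltm /= => /andP[_].
by case: b tp => // ->.
Qed.

Lemma sum_local_choices (K : pzRingType) (F : nat -> K) ok M :
  \sum_(c <- local_choices ok M) F c.1 =
  \sum_(0 <= m < M.+1 | ok (m, false)) F m +
  \sum_(0 <= m < M.+1 | (0 < m)%N && ok (m, true)) F m.
Proof.
rewrite big_filter big_mkcond big_allpairs_dep /=.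
rewrite [X in _ = X + _]big_mkcond [X in _ = _ + X]big_mkcond -big_split /=.
by apply: eq_bigr => m _; rewrite !big_cons big_nil /= addr0.
Qed.

Lemma sum_geom_tail (K : comNzRingType) (y : K) lo M : (lo <= M)%N ->
  (1 - y) * \sum_(0 <= m < M.+1 | (lo <= m)%N) y ^+ m = y ^+ lo - y ^+ M.+1.
Proof.
move=> loM; have -> : \sum_(0 <= m < M.+1 | (lo <= m)%N) y ^+ m =
    \sum_(lo <= m < M.+1) y ^+ m by rewrite [RHS](big_nat_widenl _ 0).
rewrite mulr_sumr.
under eq_bigr do rewrite mulrBl mul1r -exprS -opprB.
by rewrite sumrN telescope_sumr ?leqW // opprB.
Qed.

(** * Limits of the local sums and product of the local factors *)

Section Limits.
Variable K : numFieldType.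
Hypothesis cvg_expr0 : forall y : K, `|y| < 1 ->
  y ^+ n @[n --> \oo] --> (0 : K).
Implicit Types x y : K.

Lemma sub1_neq0 y : `|y| < 1 -> 1 - y != 0.
Proof. by rewrite subr_eq0; apply: contraTneq => <-; rewrite normr1 ltxx. Qed.

Lemma add1_neq0 y : `|y| < 1 -> 1 + y != 0.
Proof. by move=> y1; rewrite -[y]opprK sub1_neq0 ?normrN. Qed.

Lemma norm_expr_lt1 x t : `|x| < 1 -> (0 < t)%N -> `|x ^+ t| < 1.
Proof. by move=> x1 t0; rewrite normrX exprn_ilt1 // -lt0n. Qed.

Lemma cvg_geom_tail y lo : `|y| < 1 ->
  \sum_(0 <= m < M.+1 | (lo <= m)%N) y ^+ m @[M --> \oo] --> y ^+ lo / (1 - y).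
Proof.
move=> y1; have ny := sub1_neq0 y1.
have h : (y ^+ lo - y ^+ M.+1) / (1 - y) @[M --> \oo] -->
    (y ^+ lo - 0) / (1 - y).
  apply: cvgMl; apply: cvgB; first exact: cvg_cst.
  by have := cvg_expr0 y1; rewrite -cvg_shiftS.
rewrite subr0 in h; apply: cvg_trans h; apply: near_eq_cvg.
exists lo => // M /= loM; rewrite -(sum_geom_tail y loM).
by rewrite mulrC mulKf.
Qed.

Lemma cvg_geom_slice y lo hi : (lo <= hi)%N -> `|y| < 1 ->
  \sum_(0 <= m < M.+1 | (lo <= m < hi)%N) y ^+ m @[M --> \oo] -->
  (y ^+ lo - y ^+ hi) / (1 - y).
Proof.
move=> lohi y1; rewrite mulrBl.
have e M : \sum_(0 <= m < M.+1 | (lo <= m < hi)%N) y ^+ m =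
    \sum_(0 <= m < M.+1 | (lo <= m)%N) y ^+ m -
    \sum_(0 <= m < M.+1 | (hi <= m)%N) y ^+ m.
  rewrite [X in _ = X - _](bigID (fun m => (m < hi)%N)) /=.
  rewrite -addrA -[LHS]addr0; congr (_ + _); apply/esym/eqP.
  rewrite subr_eq0; apply/eqP; apply: eq_bigl => m.
  by rewrite -leqNgt andb_idl // => /(leq_trans lohi).
by under eq_fun do rewrite e; apply: cvgB; exact: cvg_geom_tail.
Qed.

(** The constrained local generating function divided by the free one, [(1 + y) / (1 - y)] with
    [y = x ^+ t]. *)
Definition mes_factor (r A a m : nat) x (t : nat) : K :=
  if t == a %[mod A] then
    if (t < m)%N then x ^+ t ^+ r / (1 + x ^+ t)
    else if t == m then 1 - 2 * x ^+ t ^+ r / (1 + x ^+ t) else 1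
  else 1.

Lemma cvg_local_sum r A a m x t : (0 < r)%N -> (0 < t)%N -> `|x| < 1 ->
  \sum_(c <- local_choices (mes_profile r A a m t) M) x ^+ (t * c.1)
    @[M --> \oo] --> (1 + x ^+ t) / (1 - x ^+ t) * mes_factor r A a m x t.
Proof.
move=> r0 t0 x1; have y1 := norm_expr_lt1 x1 t0.
under eq_fun do rewrite (sum_local_choices (fun i => x ^+ (t * i))).
under eq_fun do under eq_bigr do rewrite exprM.
under eq_fun do under [X in _ + X]eq_bigr do rewrite exprM.
rewrite /mes_factor /mes_profile; move: (x ^+ t) y1 => y y1.
have n1 := sub1_neq0 y1; have n2 := add1_neq0 y1.
(* Non-overlined choices give [1 / (1 - y)]; overlined ones start at multiplicity 1 and give
   [y / (1 - y)]. *)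
have free : \sum_(0 <= i < M.+1 | true) y ^+ i +
    \sum_(0 <= i < M.+1 | (0 < i)%N && true) y ^+ i @[M --> \oo] -->
    (1 + y) / (1 - y) * 1.
  rewrite mulr1 mulrDl.
  apply: (cvgD (@cvg_geom_tail _ 0 y1)).
  under eq_fun do under eq_bigl do rewrite andbT.
  exact: (@cvg_geom_tail _ 1 y1).
case: (t == a %[mod A]) => //=; case: ifP => ltm.
  under eq_fun do under eq_bigl do rewrite andbT.
  under eq_fun do under [X in _ + X]eq_bigl do rewrite andbF andbF.
  under eq_fun do rewrite [X in _ + X]big_pred0 // addr0.
  have -> : (1 + y) / (1 - y) * (y ^+ r / (1 + y)) = y ^+ r / (1 - y).
    by field; rewrite n1.
  exact: cvg_geom_tail.
case: eqP => //= _.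
(* At [t = m] the multiplicity runs from 0 to [r - 1] without an overline and from 1 to [r - 1] with
   one. *)
have -> : (1 + y) / (1 - y) * (1 - 2 * y ^+ r / (1 + y)) =
   (y ^+ 0 - y ^+ r) / (1 - y) + (y ^+ 1 - y ^+ r) / (1 - y).
  by rewrite expr0 expr1; field; rewrite n1.
apply: cvgD; exact: cvg_geom_slice.
Qed.

Lemma cvg_prod_nat (F : nat -> nat -> K) (l : nat -> K) N :
  (forall t, (0 < t)%N -> F t M @[M --> \oo] --> l t) ->
  \prod_(1 <= t < N.+1) F t M @[M --> \oo] --> \prod_(1 <= t < N.+1) l t.
Proof.
move=> cF; elim: N => [|N IH].
  by rewrite big_geq //; under eq_fun do rewrite big_geq //; exact: cvg_cst.
rewrite big_nat_recr //=; under eq_fun do rewrite big_nat_recr //=.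
by apply: cvgM => //; exact: cF.
Qed.

(** Only the sizes [j * A + a] with [j <= k] have a factor other than 1, and [m <= N] ensures that
    all of them occur. The factor at [j = k] produces the difference. *)
Lemma prod_mes_factor r A a k N x (m := (k * A + a)%N) :
  (0 < a)%N -> (a <= A)%N -> (m <= N)%N -> `|x| < 1 ->
  \prod_(1 <= t < N.+1) mes_factor r A a m x t =
  x ^+ (r * (A * 'C(k, 2) + k * a)) / \prod_(i < k) (1 + x ^+ a * x ^+ A ^+ i)
  - 2 * x ^+ (r * (A * 'C(k.+1, 2) + k.+1 * a)) /
    \prod_(i < k.+1) (1 + x ^+ a * x ^+ A ^+ i).
Proof.
move=> a0 aA mN x1; have A0 := leq_trans a0 aA.
pose S := [seq (j * A + a)%N | j <- index_iota 0 k.+1].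
have -> : \prod_(1 <= t < N.+1) mes_factor r A a m x t =
    \prod_(t <- S) mes_factor r A a m x t.
  rewrite (bigID (mem S)) /= [X in _ * X]big1_seq ?mulr1.
    rewrite -big_filter; apply: perm_big; apply: uniq_perm.
    - exact/filter_uniq/iota_uniq.
    - rewrite map_inj_uniq ?iota_uniq // => i j /addIn/eqP.
      by rewrite eqn_pmul2r // => /eqP.
    move=> t; rewrite mem_filter andb_idr // => /mapP[j].
    rewrite !mem_index_iota => /andP[_ jk] ->.
    rewrite addn_gt0 a0 orbT ltnS (leq_trans _ mN) // leq_add2r leq_mul2r.
    by rewrite -ltnS jk orbT.
  move=> t /andP[/negP tS]; rewrite mem_index_iota => /andP[t0 _].
  rewrite /mes_factor; case: eqP => // /eqP ta.
  have [le_tm|lt_mt] := leqP t m; last first.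
    by rewrite ltnNge (ltnW lt_mt) /= gtn_eqF.
  have [j tj] := eqmod_arith a0 aA t0 ta; case: tS; apply/mapP; exists j => //.
  by move: le_tm; rewrite mem_index_iota ltnS tj leq_add2r leq_pmul2r.
rewrite big_map big_nat_recr //=.
have xa j : x ^+ (j * A + a) = x ^+ a * x ^+ A ^+ j.
  by rewrite exprD mulrC mulnC exprM.
have nz j : 1 + x ^+ a * x ^+ A ^+ j != 0.
  by rewrite -xa add1_neq0 // norm_expr_lt1 // addn_gt0 a0 orbT.
have -> : \prod_(0 <= j < k) mes_factor r A a m x (j * A + a) =
   x ^+ (r * (A * 'C(k, 2) + k * a)) / \prod_(i < k) (1 + x ^+ a * x ^+ A ^+ i).
  rewrite big_mkord (eq_bigr (fun j : 'I_k =>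
    x ^+ (j * A + a) ^+ r / (1 + x ^+ a * x ^+ A ^+ j))); last first.
    move=> j _; rewrite /mes_factor modnMDl eqxx /m ltn_add2r ltn_mul2r A0.
    by rewrite ltn_ord -xa.
  rewrite big_split /= prodfV; congr (_ / _).
  rewrite mulnC exprM prodrXl; congr (_ ^+ _).
  (* The sum of [j * A + a] over [j < k] is [A * 'C(k, 2) + k * a]. *)
  elim: (k) => [|n IH]; first by rewrite big_ord0 bin0n muln0 mul0n.
  rewrite big_ord_recr /= IH -exprD binS bin1; congr (_ ^+ _); lia.
rewrite /mes_factor modnMDl eqxx ltnn eqxx -/m mulrBr mulr1; congr (_ - _).
rewrite [in RHS]big_ord_recr /= -xa -/m.
have -> : (r * (A * 'C(k.+1, 2) + k.+1 * a) =
           r * (A * 'C(k, 2) + k * a) + m * r)%N.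
  by rewrite /m binS bin1; lia.
rewrite exprD exprM [x ^+ (m * r)]exprM.
by rewrite invfM; ring.
Qed.
End Limits.

(** * The generating function *)

Section Assembly.
Variable K : numFieldType.
Hypothesis cvg_expr0 : forall y : K, `|y| < 1 ->
  y ^+ n @[n --> \oo] --> (0 : K).
Hypothesis cvg_qprod : forall x q : K, `|x| < 1 -> `|q| < 1 ->
  exists2 l : K, l != 0 & \prod_(i < n) (1 - x * q ^+ i) @[n --> \oo] --> l.

Lemma qpoch_infP (x q : K) : `|x| < 1 -> `|q| < 1 ->
  qpoch_inf x q != 0 /\
  (\prod_(i < n) (1 - x * q ^+ i) @[n --> \oo] --> qpoch_inf x q).
Proof.
move=> x1 q1; have [l l0 cl] := cvg_qprod x1 q1.
by rewrite /qpoch_inf (cvg_lim (@norm_hausdorff _ _) cl).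
Qed.

(** The infinite product splits after [k] factors, and the remaining tail cancels because its limit
    is nonzero. *)
Lemma qpochE (x q : K) k : `|x| < 1 -> `|q| < 1 ->
  qpoch x q k = \prod_(i < k) (1 - x * q ^+ i).
Proof.
move=> x1 q1; have xk1 : `|x * q ^+ k| < 1.
  rewrite normrM normrX; apply: le_lt_trans x1.
  by rewrite ler_piMr // exprn_ile1 // ltW.
have [_ cx] := qpoch_infP x1 q1; have [nk ck] := qpoch_infP xk1 q1.
rewrite /qpoch; apply: (canLR (mulfK nk)).
have h : \prod_(i < n + k) (1 - x * q ^+ i) @[n --> \oo] --> qpoch_inf x q.
  by have := cx; rewrite -(cvg_shiftn k).
have h' : \prod_(i < n + k) (1 - x * q ^+ i) @[n --> \oo] -->
    \prod_(i < k) (1 - x * q ^+ i) * qpoch_inf (x * q ^+ k) q.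
  under eq_fun do rewrite addnC big_split_ord /=.
  apply: cvgMr; apply: cvg_trans ck; apply: near_eq_cvg; near=> n.
  by apply: eq_bigr => i _; rewrite exprD mulrA.
exact: (cvg_unique _ h h').
Unshelve. all: by end_near. Qed.

(** The bracket of the formula, kept as a function of [x] so that it can be taken at both [q] and
    its norm. *)
Definition mes_coef (r A a k : nat) (x : K) : K :=
  x ^+ (r * (A * 'C(k, 2) + k * a)) / qpoch (- x ^+ a) (x ^+ A) k
  - 2 * x ^+ (r * (A * 'C(k.+1, 2) + k.+1 * a))
    / qpoch (- x ^+ a) (x ^+ A) k.+1.

Lemma cvg_prod_local r A a k x (m := (k * A + a)%N) :
  (0 < a)%N -> (a <= A)%N -> `|x| < 1 ->
  \prod_(1 <= t < N.+1) ((1 + x ^+ t) / (1 - x ^+ t) * mes_factor r A a m x t)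
    @[N --> \oo] --> qpoch_inf (- x) x / qpoch_inf x x * mes_coef r A a k x.
Proof.
move=> a0 aA x1; have A0 := leq_trans a0 aA.
have nx1 : `|- x| < 1 by rewrite normrN.
have [_ cn] := qpoch_infP nx1 x1; have [nz cd] := qpoch_infP x1 x1.
have h : (\prod_(i < N) (1 - - x * x ^+ i)) / (\prod_(i < N) (1 - x * x ^+ i)) *
   mes_coef r A a k x @[N --> \oo] -->
   qpoch_inf (- x) x / qpoch_inf x x * mes_coef r A a k x.
  by apply: cvgMl; apply: cvgM => //; exact: cvgV.
(* From [N = m] on, the product of the constrained factors is constant; only the free factors still
   vary. *)
apply: cvg_trans h; apply: near_eq_cvg; exists m => // N /= mN.
rewrite big_split /= prod_mes_factor // /mes_coef.
rewrite !qpochE ?normrN ?norm_expr_lt1 //.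
congr (_ * (_ / _ - _ / _)).
- rewrite big_add1 /= big_mkord big_split /= prodfV; congr (_ / _).
    by apply: eq_bigr => i _; rewrite exprS mulNr opprK.
  by apply: eq_bigr => i _; rewrite exprS.
- by apply: eq_bigr => i _; rewrite mulNr opprK.
by apply: eq_bigr => i _; rewrite mulNr opprK.
Qed.

(** First [N] is chosen for the infinite products, then [M], depending on [N], for the local sums.
    One pair serves [x] and [y] at once, since unordered convergence needs a common finite set. *)
Lemma truncations_approx r A a k (x y : K) (m := (k * A + a)%N)
    (T := truncations (mes_profile r A a m))
    (L := fun x => qpoch_inf (- x) x / qpoch_inf x x * mes_coef r A a k x)
    (e : K) n0 :
  (0 < a)%N -> (a <= A)%N -> (0 < r)%N -> `|x| < 1 -> `|y| < 1 -> 0 < e ->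
  exists M N, [/\ (n0 <= M)%N, (n0 <= N)%N,
    `|L x - \sum_(s <- T M N) x ^+ sumn (part_sizes s)| < e &
    `|L y - \sum_(s <- T M N) y ^+ sumn (part_sizes s)| < e].
Proof.
move=> a0 aA r0 x1 y1 e0; have e2 : 0 < e / 2%:R by rewrite divr_gt0.
pose P (z : K) N :=
  \prod_(1 <= t < N.+1) ((1 + z ^+ t) / (1 - z ^+ t) * mes_factor r A a m z t).
pose S (z : K) M N := \sum_(s <- T M N) z ^+ sumn (part_sizes s).
have PN z : `|z| < 1 -> \forall N \near \oo, `|L z - P z N| < e / 2%:R.
  move=> z1.
  by have /cvgrPdist_lt/(_ _ e2) := @cvg_prod_local r A a k z a0 aA z1.
have SM z N : `|z| < 1 -> \forall M \near \oo, `|P z N - S z M N| < e / 2%:R.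
  move=> z1; have := @cvg_prod_nat _ _ _ N
    (fun t t0 => @cvg_local_sum K cvg_expr0 r A a m z t r0 t0 z1).
  move/cvgrPdist_lt/(_ _ e2); apply: filterS => M.
  by rewrite /S sum_truncations.
have [N [n0N Nx Ny]] : exists N,
    [/\ (n0 <= N)%N, `|L x - P x N| < e / 2%:R & `|L y - P y N| < e / 2%:R].
  have PNx := PN _ x1; have PNy := PN _ y1; near \oo => N; exists N; split.
  - by near: N; exists n0.
  - by near: N.
  - by near: N.
have [M [n0M Mx My]] : exists M,
    [/\ (n0 <= M)%N, `|P x N - S x M N| < e / 2%:R &
        `|P y N - S y M N| < e / 2%:R].
  have SMx := SM _ N x1; have SMy := SM _ N y1; near \oo => M; exists M; split.
  - by near: M; exists n0.
  - by near: M.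
  - by near: M.
have tri z : `|L z - P z N| < e / 2%:R -> `|P z N - S z M N| < e / 2%:R ->
    `|L z - S z M N| < e.
  move=> h1 h2; rewrite [ltRHS]splitr.
  by apply: le_lt_trans (ler_distD (P z N) _ _) _; rewrite ltrD.
by exists M, N; split => //; exact: tri.
Unshelve. all: by end_near. Qed.

(** The norms of the terms form the same series at [|q|], so the two approximations required are
    those at [q] and at [|q|]. *)
Lemma cvg_lhs r A a k (q : K) (m := (k * A + a)%N) :
  (0 < a)%N -> (a <= A)%N -> (0 < r)%N -> `|q| < 1 ->
  partial_sum (fun p : {p : overpartition | Nmes r A a p} =>
      zmonomial (q ^+ weight (val p)) (mes r A a (val p)) m) J
    @[J --> totally] -->
  qpoch_inf (- q) q / qpoch_inf q q * mes_coef r A a k q.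
Proof.
move=> a0 aA r0 q1; set f := fun p : {p | _} => _.
have nq1 : `| `|q| | < 1 by rewrite normr_id.
apply: (@cvg_partial_sum _ _ _ _
  (qpoch_inf (- `|q|) `|q| / qpoch_inf `|q| `|q| * mes_coef r A a k `|q|)).
move=> J e e0.
(* The term [m] leaves sizes beyond [N] unconstrained; the weights bound every part and every
   multiplicity occurring in [J]. *)
pose n0 := (m + \sum_(p <- J) weight (val p))%N.
have [M [N [n0M n0N hq hn]]] :=
  @truncations_approx r A a k q `|q| e n0 a0 aA r0 q1 nq1 e0.
pose g (p : {p : overpartition | Nmes r A a p}) := parts (val p).
have okT u : u \in truncations (mes_profile r A a m) M N ->
    forall t, (0 < t)%N -> mes_profile r A a m t (profile u t).
  move=> /truncationsP[_ _ ok] t t0; have [tN|Nt] := leqP t N.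
    by have := ok t; rewrite t0 tN => /(_ isT)/andP[].
  have mt : (m < t)%N by lia.
  by rewrite /mes_profile ltnNge (ltnW mt) (gtn_eqF mt) implybT.
have [s gs] : exists s, map g s = truncations (mes_profile r A a m) M N.
  apply: exists_map => u uT; have [ou _ _] := truncationsP _ _ _ _ uT.
  have /andP[_ Nu] :=
    introT (@mes_NmesP r A a k (Overpartition ou) a0 aA r0) (okT u uT).
  by exists (exist (fun p => is_true (Nmes r A a p)) _ Nu).
have mes_s p : p \in s -> mes r A a (val p) = m.
  move=> /(map_f g); rewrite gs => /okT.
  by move/(introT (@mes_NmesP r A a k (val p) a0 aA r0)) => /andP[/eqP].
exists s; split.
- by apply: (@map_uniq _ _ g); rewrite gs uniq_truncations.
(* If [mes] differs from [m] the coefficient is 0, and [p] need not be among the truncations. *)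
- move=> p pJ; rewrite /f /zmonomial; case: (m =P _) => [mp _|];
    last by rewrite eqxx.
  have gi : injective g by move=> p1 p2 /val_inj/val_inj.
  rewrite -(mem_map gi) gs.
  have wn0 : (weight (val p) <= n0)%N.
    by rewrite /n0 (big_rem p) //=; lia.
  apply/truncationsP; split; first exact: (partsP (val p)).
    apply/allP => -[t b] tp /=; apply: leq_trans n0N; apply: leq_trans wn0.
    by apply: leq_sumn; apply/mapP; exists (t, b).
  move=> t /andP[t0 tN]; apply/andP; split; last first.
    have := elimT (@mes_NmesP r A a k (val p) a0 aA r0); apply => //.
    by rewrite -mp eqxx (valP p).
  apply: leq_trans n0M; apply: leq_trans wn0; exact: count_mem_leq_sumn.
- suff -> : \sum_(i <- s) f i = \sum_(u <- map g s) q ^+ sumn (part_sizes u).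
    by rewrite gs.
  rewrite big_map !big_seq; apply: eq_bigr => p /mes_s mp.
  by rewrite /f /zmonomial mp eqxx.
suff -> : \sum_(i <- s) `|f i| =
    \sum_(u <- map g s) `|q| ^+ sumn (part_sizes u).
  by rewrite gs.
rewrite big_map !big_seq; apply: eq_bigr => p /mes_s mp.
by rewrite /f /zmonomial mp eqxx normrX.
Qed.

End Assembly.

(** Coefficientwise comparison: at [m = k * A + a] the right-hand sum has the single index [k]; at
    any other [m] all terms on both sides vanish. *)
Lemma zsum_mes (K : numFieldType)
    (cvg_expr0 : forall y : K, `|y| < 1 -> y ^+ n @[n --> \oo] --> (0 : K))
    (cvg_qprod : forall x q : K, `|x| < 1 -> `|q| < 1 -> exists2 l : K, l != 0 &
       \prod_(i < n) (1 - x * q ^+ i) @[n --> \oo] --> l)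
    (q : K) (A a r : nat) :
  (1 <= a)%N -> (a <= A)%N -> (1 <= r)%N -> `|q| < 1 ->
  let lhs := fun p : {p : overpartition | Nmes r A a p} =>
    zmonomial (q ^+ weight (val p)) (mes r A a (val p)) in
  let rhs := fun k : nat => zmonomial (mes_coef r A a k q) (k * A + a) in
  [/\ zsummable lhs, zsummable rhs &
      zsum lhs = zscale (qpoch_inf (- q) q / qpoch_inf q q) (zsum rhs)].
Proof.
move=> a0 aA r0 q1 lhs rhs.
have H m : exists c, (partial_sum (lhs^~ m) J @[J --> totally] -->
      qpoch_inf (- q) q / qpoch_inf q q * c) /\
    (partial_sum (rhs^~ m) J @[J --> totally] --> c).
  have [[k ->]|nk] := pselect (exists k, m = (k * A + a)%N).
    exists (mes_coef r A a k q); split; first exact: cvg_lhs.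
    have -> : mes_coef r A a k q = rhs k (k * A + a)%N.
      by rewrite /rhs /zmonomial eqxx.
    apply: (@cvg_partial_sum1 _ _ (fun i => rhs i (k * A + a)%N)) => i ik.
    rewrite /rhs /zmonomial eqn_add2r eqn_pmul2r ?(leq_trans a0) //.
    by rewrite eq_sym (negbTE ik).
  exists 0; rewrite mulr0; split; apply: cvg_partial_sum0 => i.
    have [k ek] := mes_arith (val i) a0 aA r0.
    rewrite /lhs /zmonomial; case: eqP => // e.
    by case: nk; exists k; rewrite e ek.
  by rewrite /rhs /zmonomial; case: eqP => // e; case: nk; exists i.
split=> [m|m|].
- by have [c [cl _]] := H m; exact: (cvgP _ cl).
- by have [c [_ cr]] := H m; exact: (cvgP _ cr).
apply/funext => m; have [c [cl cr]] := H m.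
rewrite /zsum /zscale (cvg_lim (@norm_hausdorff _ _) cl).
by rewrite (cvg_lim (@norm_hausdorff _ _) cr).
Qed.

Theorem theorem2p3 (R : realType) (q : R[i]) (A a r : nat) :
  (1 <= a)%N -> (a <= A)%N -> (1 <= r)%N -> `|q| < 1 ->
  let lhs := fun p : {p : overpartition | Nmes r A a p} =>
    zmonomial (q ^+ weight (val p)) (mes r A a (val p)) in
  let rhs := fun k : nat =>
    zmonomial
      (q ^+ (r * (A * 'C(k, 2) + k * a)) / qpoch (- q ^+ a) (q ^+ A) k
       - 2 * q ^+ (r * (A * 'C(k.+1, 2) + k.+1 * a))
         / qpoch (- q ^+ a) (q ^+ A) k.+1)
      (k * A + a) in
  [/\ zsummable lhs, zsummable rhs &
      zsum lhs = zscale (qpoch_inf (- q) q / qpoch_inf q q) (zsum rhs)].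
Proof.
exact: (zsum_mes (@cvg_expr_lt1 R) (@cvg_qpoch_inf R)).
Qed.
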